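(* Let $M_1=(N,\mathcal{I}_1),\dots,M_k=(N,\mathcal{I}_k)$ be matroids on a common ground set $N$ with weights $w\colon N\to\mathbb{R}_{\ge0}$, let $\mathcal{F}=\bigcap_{j=1}^k\mathcal{I}_j$, and let $\mathrm{OPT}$ be the maximum-weight set in $\mathcal{F}$. For $S\subseteq N$ define $w'\colon N\to\mathbb{R}_{\ge0}$ by $w'(e)=w(e)$ if $e\in N\setminus S$ and $e\in\mathrm{Greedy}(S\cup\{e\})$, and $w'(e)=0$ otherwise; for $j\in[k]$ let $\mathrm{OPT}'_j$ be the maximum-weight independent set of $M_j$ with respect to $w'$, containing no element of $w'$-weight $0$. Then for $p=\frac{2k-1}{2k}$, $$\mathbb{E}_{S\sim\mu_p}\left[w'\left(\bigcap_{j=1}^k\mathrm{OPT}'_j\right)\right]\ge\frac{1}{4k^2}\,w(\mathrm{OPT}).$$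
   Context: Ties in weights are broken by a fixed consistent rule, so the elements are ordered $e_1,\dots,e_n$ with $e_i$ at least as large as $e_{i+1}$; all optima are unique and contain no elements of weight $0$. $\mathrm{Greedy}(S)$ for $S\subseteq N$ is the output of the greedy algorithm run on $S$: start with $G=\varnothing$ and, scanning the elements of $S$ in the order $e_1,\dots,e_n$, add $e_i$ to $G$ whenever $G\cup\{e_i\}\in\mathcal{F}$. $\mu_p$ is the distribution over subsets of $N$ including each element independently with probability $p$. *)

(* Defs.v *)
From HB Require Import structures.
From mathcomp Require Import all_boot all_order all_algebra.

Set Implicit Arguments.
Unset Strict Implicit.
Unset Printing Implicit Defensive.

Import Order.TTheory GRing.Theory Num.Theory.
Local Open Scope ring_scope.

Record matroid (T : finType) := Matroid {
  indep :> {set {set T}};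
  indep0 : set0 \in indep;
  indepS : forall A B : {set T}, A \subset B -> B \in indep -> A \in indep;
  indep_exchange : forall A B : {set T}, A \in indep -> B \in indep ->
    (#|A| < #|B|)%N -> exists2 x, x \in B :\: A & x |: A \in indep
}.

Definition common_indep (T : finType) (k : nat) (M : 'I_k -> matroid T) :
  {set {set T}} := \bigcap_(j < k) indep (M j).

Definition wt (R : realFieldType) (T : finType) (u : T -> R) (A : {set T}) : R :=
  \sum_(x in A) u x.

(* Throughout, [e] enumerates the ground set by non-increasing weight, ties
   having been broken. *)
Definition weight_ordering (R : realFieldType) (T : finType) (w : T -> R)
  (e : seq T) : Prop :=
  [/\ uniq e, forall x, x \in e & sorted (fun x y => w y <= w x) e].

Definition greedy (T : finType) (e : seq T) (F : {set {set T}}) (S : {set T}) :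
  {set T} :=
  foldl (fun G x => if (x \in S) && (x |: G \in F) then x |: G else G) set0 e.

(* Tie-breaking between sets of equal weight: the set containing the first
   element of [e] on which the two sets differ is preferred.  Equivalently,
   the weights are perturbed by infinitesimals decreasing along [e], each
   infinitely smaller than the preceding one. *)
Definition preferred (T : finType) (e : seq T) (X Y : {set T}) : bool :=
  (X == Y) ||
  [exists x in X :\: Y, [forall y in Y :\: X, (index x e < index y e)%N]].

Definition max_weight (R : realFieldType) (T : finType) (F : {set {set T}})
  (u : T -> R) (X : {set T}) : bool :=
  [&& X \in F, [forall Y in F, wt u Y <= wt u X] & [forall x in X, u x != 0]].

Definition is_opt (R : realFieldType) (T : finType) (e : seq T)
  (F : {set {set T}}) (u : T -> R) (X : {set T}) : bool :=
  max_weight F u X && [forall Y, max_weight F u Y ==> preferred e X Y].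

(* The default value is never used when [F] is an independence system:
   see [optP] and [is_opt_uniq]. *)
Definition opt (R : realFieldType) (T : finType) (e : seq T)
  (F : {set {set T}}) (u : T -> R) : {set T} :=
  odflt set0 [pick X | is_opt e F u X].

Definition residual_weight (R : realFieldType) (T : finType) (e : seq T)
  (F : {set {set T}}) (w : T -> R) (S : {set T}) (x : T) : R :=
  if (x \notin S) && (x \in greedy e F (x |: S)) then w x else 0.

Definition mu (R : realFieldType) (T : finType) (p : R) (S : {set T}) : R :=
  \prod_(x : T) (if x \in S then p else 1 - p).

Definition expect_mu (R : realFieldType) (T : finType) (p : R)
  (X : {set T} -> R) : R := \sum_(S : {set T}) mu p S * X S.

Section Preferred.
Variables (T : finType) (e : seq T).

Lemma preferred_refl : reflexive (preferred e).
Proof. by move=> X; rewrite /preferred eqxx. Qed.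

Lemma preferredP (X Y : {set T}) :
  reflect (X = Y \/ exists2 x, (x \in X) && (x \notin Y) &
     forall y, y \in Y -> y \notin X -> (index x e < index y e)%N)
    (preferred e X Y).
Proof.
apply: (iffP orP) => [[/eqP|/exists_inP[x]]|[/eqP|[x /andP[xX xY] H]]].
- by left.
- rewrite inE => /andP[xY xX] /forall_inP H; right; exists x; first by rewrite xX.
  by move=> y yY yX; apply: H; rewrite inE yX.
- by left.
- right; apply/exists_inP; exists x; first by rewrite inE xY.
  by apply/forall_inP => y; rewrite inE => /andP[yX yY]; apply: H.
Qed.

Lemma preferred_anti : antisymmetric (preferred e).
Proof.
move=> X Y /andP[/preferredP[//|[x /andP[xX xY] Hx]] /preferredP[//|]].
move=> [y /andP[yY yX] Hy].
by have := ltn_trans (Hx y yY yX) (Hy x xX xY); rewrite ltnn.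
Qed.

Lemma preferred_trans : transitive (preferred e).
Proof.
move=> Y X Z /preferredP[->//|[x /andP[xX xY] Hx]].
move=> /preferredP[<-|[y /andP[yY yZ] Hy]].
  by apply/preferredP; right; exists x; rewrite ?xX.
apply/preferredP; right.
case: (ltngtP (index x e) (index y e)) => [ltxy|ltyx|eqxy].
- exists x.
    rewrite xX; apply/negP => xZ.
    by have := ltn_trans ltxy (Hy x xZ xY); rewrite ltnn.
  move=> z zZ zX; have [zY|zY] := boolP (z \in Y); first exact: Hx.
  exact: ltn_trans ltxy (Hy z zZ zY).
- exists y.
    rewrite yZ andbT; apply/negPn/negP => yX.
    by have := ltn_trans ltyx (Hx y yY yX); rewrite ltnn.
  move=> z zZ zX; have [zY|zY] := boolP (z \in Y); last exact: Hy.
  exact: ltn_trans ltyx (Hx z zY zX).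
- exists x.
    rewrite xX; apply/negP => xZ.
    by have := Hy x xZ xY; rewrite eqxy ltnn.
  move=> z zZ zX; have [zY|zY] := boolP (z \in Y); first exact: Hx.
  by rewrite eqxy; apply: Hy.
Qed.

Hypothesis e_all : forall x, x \in e.

Lemma preferred_total : total (preferred e).
Proof.
move=> X Y; have [->|neqXY] := eqVneq X Y; first by rewrite preferred_refl.
have [x0 x0P] : exists x, (x \in X) != (x \in Y).
  apply/existsP; rewrite -negb_forall; apply: contra neqXY => /forallP H.
  by apply/eqP/setP => x; apply/eqP.
case: (@arg_minnP T x0 (fun x => (x \in X) != (x \in Y)) (index^~ e) x0P)
  => x xXY xmin.
have lt_x y : (y \in X) != (y \in Y) -> y != x -> (index x e < index y e)%N.
  move=> yXY; apply: contra_neqT; rewrite -leqNgt => le_yx.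
  have eq_yx : index y e = index x e by apply/eqP; rewrite eqn_leq le_yx xmin.
  by rewrite -(nth_index x (e_all y)) eq_yx nth_index.
have [xX|xX] := boolP (x \in X); rewrite ?xX ?(negPf xX) in xXY.
- apply/orP; left; apply/preferredP; right; exists x.
    by rewrite xX; case: (x \in Y) xXY.
  move=> y yY yX; apply: lt_x; first by rewrite yY (negPf yX).
  by apply: contraNneq yX => ->.
- have xY : x \in Y by case: (x \in Y) xXY.
  apply/orP; right; apply/preferredP; right; exists x; first by rewrite xY.
  move=> y yX yY; apply: lt_x; first by rewrite yX (negPf yY).
  by apply: contraNneq yY => ->.
Qed.

Variables (R : realFieldType) (F : {set {set T}}) (u : T -> R).

Lemma is_opt_uniq (X Y : {set T}) : is_opt e F u X -> is_opt e F u Y -> X = Y.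
Proof.
move=> /andP[mX /forallP pX] /andP[mY /forallP pY]; apply: preferred_anti.
by rewrite (implyP (pX Y) mY) (implyP (pY X) mX).
Qed.

Hypothesis F0 : set0 \in F.
Hypothesis FS : forall A B : {set T}, A \subset B -> B \in F -> A \in F.

Lemma optP : is_opt e F u (opt e F u).
Proof.
suff [X optX] : exists X, is_opt e F u X.
  by rewrite /opt; case: pickP => [//|/(_ X)]; rewrite optX.
case: (@arg_maxP _ _ _ set0 (fun A => A \in F) (wt u) F0) => B BF Bmax.
pose A := [set x in B | u x != 0].
have wA : wt u A = wt u B.
  rewrite /wt [RHS](bigID (fun x => u x != 0)) /= [X in _ + X]big1 ?addr0.
    by apply: eq_bigl => x; rewrite inE.
  by move=> x /andP[_ /negPn/eqP].
have mA : max_weight F u A.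
  apply/and3P; split.
  - by apply: FS BF; apply/subsetP => x; rewrite inE => /andP[].
  - by apply/forall_inP => Y YF; rewrite wA; apply: Bmax.
  - by apply/forall_inP => x; rewrite inE => /andP[].
have [X mX Xpref] := @extremumP _ _ (preferred e) A (max_weight F u) id
  preferred_refl preferred_trans preferred_total mA.
exists X; apply/andP; split=> //.
by apply/forallP => Y; apply/implyP; apply: Xpref.
Qed.

End Preferred.

(* Main.v *)
Require Import Defs.
From HB Require Import structures.
From mathcomp Require Import all_boot all_order all_algebra.
From mathcomp Require Import ring lra.

Set Implicit Arguments.
Unset Strict Implicit.
Unset Printing Implicit Defensive.

Import Order.TTheory GRing.Theory Num.Theory.
Local Open Scope ring_scope.

(* Call [x] available for [S] if the greedy solution built on [S] before
   reaching [x] can be augmented by [x].  Availability does not depend on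
   whether [x] is in [S]: an available element enters the greedy solution with
   probability [p], and has positive residual weight with probability [q = 1 - p].
   Call an available [x] blocked in [M j] if the earlier available elements
   span it in [M j].  In every prefix of the ordering, the available elements
   that are not blocked are as many as the rank of the available set, which is
   at least the size of the greedy solution.  So, with expected numbers [A] of
   available and [B j] of blocked elements, [p * A <= A - B j], i.e.
   [B j <= q * A].  A residual element outside [OPT' j] is blocked in [M j], and
   being blocked does not depend on [x \in S] either; hence the intersection
   of the [OPT' j] retains at least [q * (A - k * q * A) = A / (4 * k)] elements
   of the prefix in expectation.  Finally [k * A] is at least
   the number of elements of [OPT] in the prefix, by the usual analysis of
   greedy.  Abel summation turns these counts over prefixes into weights. *)

(** * Rank and span in a matroid *)

Section MatroidRank.
Variables (T : finType) (M : matroid T).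
Implicit Types (A B I J : {set T}) (x : T).

Definition rank A : nat := \max_(B in indep M | B \subset A) #|B|.

(** Membership in the closure of [A], stated through ranks so that [A] may be dependent. *)
Definition spanned A x : bool := (rank (x |: A) <= rank A)%N.

Lemma leq_rank I A : I \in indep M -> I \subset A -> (#|I| <= rank A)%N.
Proof.
move=> IM IA.
by apply: (@leq_bigmax_cond _ (fun B => (B \in indep M) && (B \subset A))
  (fun B : {set T} => #|B|)); rewrite IM.
Qed.

Lemma rank_witness A :
  exists2 B, (B \in indep M) && (B \subset A) & #|B| = rank A.
Proof.
have [] := @eq_bigmax_cond _ (fun B => (B \in indep M) && (B \subset A))
  (fun B : {set T} => #|B|).
  by apply/card_gt0P; exists set0; rewrite unfold_in /= indep0 sub0set.
by move=> B HB E; exists B.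
Qed.

Lemma rank_indep I : I \in indep M -> rank I = #|I|.
Proof.
move=> IM; apply/eqP; rewrite eqn_leq leq_rank // andbT.
by apply/bigmax_leqP => B /andP[_]; apply: subset_leq_card.
Qed.

Lemma rankS A B : A \subset B -> (rank A <= rank B)%N.
Proof.
move=> AB; apply/bigmax_leqP => I /andP[IM IA].
exact: leq_rank IM (subset_trans IA AB).
Qed.

Lemma rankU1 x A : (rank (x |: A) <= (rank A).+1)%N.
Proof.
apply/bigmax_leqP => I /andP[IM IA].
have IxM : I :\ x \in indep M by apply: indepS IM; rewrite subD1set.
have IxA : I :\ x \subset A by rewrite subDset.
by rewrite (cardsD1 x); have := leq_rank IxM IxA; case: (x \in I) => /= H;
  rewrite ?add1n ?add0n // (leq_trans H).
Qed.

Lemma rankU1E x A : rank (x |: A) = (rank A + ~~ spanned A x)%N.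
Proof.
have r1 := rankU1 x A; have r2 := rankS (subsetUr [set x] A).
apply/eqP; rewrite /spanned eqn_leq.
by case: (leqP (rank (x |: A)) (rank A)) => /= H; rewrite ?addn0 ?addn1 ?H // r1.
Qed.

Lemma extend_to_rank I A : I \in indep M -> I \subset A ->
  exists J, [/\ J \in indep M, I \subset J, J \subset A & #|J| = rank A].
Proof.
move=> IM IA.
have [J /maxsetP[/andP[JM JA] Jmax] IJ] := @maxset_exists _
  (fun J => (J \in indep M) && (J \subset A)) I (introT andP (conj IM IA)).
exists J; split=> //; apply/eqP; rewrite eqn_leq leq_rank //= leqNgt.
apply/negP => ltJ; have [B /andP[BM BA] cB] := rank_witness A.
rewrite -cB in ltJ; have [x /setDP[xB xJ] xJM] := indep_exchange JM BM ltJ.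
have E : x |: J = J.
  apply: Jmax; last exact: subsetUr.
  by rewrite xJM subUset sub1set (subsetP BA).
by move: xJ; rewrite -E setU11.
Qed.

(** Extend a basis [I] of [A] to a basis [J] of [B]. If [x] raised the rank of [B], some element
    would augment [J]; it cannot lie in [B], so it is [x], and [x |: I] would be independent inside
    [x |: A]. *)
Lemma spannedS A B x : A \subset B -> spanned A x -> spanned B x.
Proof.
move=> AB; apply: contraTT; rewrite /spanned -!ltnNge => ltB.
have [I /andP[IM IA] cI] := rank_witness A.
have [J [JM IJ JB cJ]] := extend_to_rank IM (subset_trans IA AB).
have [K /andP[KM KB] cK] := rank_witness (x |: B).
rewrite -cK -cJ in ltB.
have [y /setDP[yK yJ] yJM] := indep_exchange JM KM ltB.
have [yB|yB] := boolP (y \in B).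
  have := @leq_rank _ B yJM; rewrite subUset sub1set yB JB => /(_ isT).
  by rewrite cardsU1 yJ cJ ltnn.
have := subsetP KB y yK; rewrite !inE (negPf yB) orbF => /eqP E.
have xIM : x |: I \in indep M by apply: indepS yJM; rewrite E setUS.
have := leq_rank xIM (setUS [set x] IA); rewrite cardsU1 cI.
by rewrite (contra (subsetP IJ x)) // -E.
Qed.

Lemma spanned_mem A x : x \in A -> spanned A x.
Proof. by move=> xA; rewrite /spanned (setUidPr _) ?sub1set. Qed.

Lemma spannedN_indep I x : I \in indep M -> x |: I \notin indep M ->
  spanned I x.
Proof.
move=> IM xIM; rewrite /spanned (rank_indep IM).
apply/bigmax_leqP => B /andP[BM BxI]; rewrite leqNgt; apply/negP => ltB.
have [y /setDP[yB yI] yIM] := indep_exchange IM BM ltB.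
have := subsetP BxI y yB; rewrite !inE (negPf yI) orbF => /eqP E.
by rewrite -E yIM in xIM.
Qed.

Lemma card_spanned A I : A \in indep M -> I \in indep M ->
  (forall x, x \in A -> spanned I x) -> (#|A| <= #|I|)%N.
Proof.
move=> AM IM sp; rewrite leqNgt; apply/negP => ltI.
have [y /setDP[yA yI] yIM] := indep_exchange IM AM ltI.
by have := sp y yA; rewrite /spanned !rank_indep // cardsU1 yI ltnn.
Qed.

End MatroidRank.

Lemma sum_bool_card (T : finType) (s : seq T) (P : pred T) : uniq s ->
  (\sum_(x <- s) P x)%N = #|[set x in s | P x]|.
Proof.
move=> us; have -> : [set x in s | P x] = [set x in [seq x <- s | P x]].
  by apply/setP => x; rewrite !inE mem_filter andbC.
rewrite cardsE (card_uniqP (filter_uniq _ us)) size_filter -sum1_count.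
by rewrite [RHS]big_mkcond; apply: eq_bigr => x _; case: ifP.
Qed.

(** * Greedy runs, available and blocked elements *)

Section Greedy.
Variables (T : finType) (F : {set {set T}}).
Implicit Types (S : {set T}) (x : T) (s : seq T).

Lemma greedy_rcons s x S : greedy (rcons s x) F S =
  if (x \in S) && (x |: greedy s F S \in F) then x |: greedy s F S
  else greedy s F S.
Proof. by rewrite /greedy foldl_rcons. Qed.

Lemma greedy_indep s S : set0 \in F -> greedy s F S \in F.
Proof.
move=> F0; elim/last_ind: s => [//|s x IH].
by rewrite greedy_rcons; case: ifP => // /andP[].
Qed.

Lemma eq_greedy s S S' : {in s, S =i S'} -> greedy s F S = greedy s F S'.
Proof.
elim/last_ind: s => [//|s x IH] SS'.
have E : greedy s F S = greedy s F S'.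
  by apply: IH => y ys; apply: SS'; rewrite mem_rcons inE ys orbT.
by rewrite !greedy_rcons E SS' // mem_rcons mem_head.
Qed.

Definition available s x S : bool :=
  x |: greedy (take (index x s) s) F S \in F.

Lemma available_cat s t x S : x \in s ->
  available (s ++ t) x S = available s x S.
Proof. by move=> xs; rewrite /available index_cat xs take_cat index_mem xs. Qed.

Lemma take_index_rcons s x : x \notin s ->
  take (index x (rcons s x)) (rcons s x) = s.
Proof.
move=> xs; rewrite -cats1 index_cat (negPf xs) /= eqxx addn0.
by rewrite take_size_cat.
Qed.

Lemma available_rcons s x S : x \notin s ->
  available (rcons s x) x S = (x |: greedy s F S \in F).
Proof.
by move=> xs; rewrite /available take_index_rcons.
Qed.

(** Only elements before [x] are consulted; this is what makes [expect_mu_indep] applicable. *)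
Lemma eq_available s x S S' : (forall y, y != x -> (y \in S) = (y \in S')) ->
  available s x S = available s x S'.
Proof.
move=> SS'; rewrite /available (@eq_greedy _ S S') // => y.
move=> yt; apply: SS'; apply: contraTneq yt => ->.
by apply/negP => /index_ltn; rewrite ltnn.
Qed.

Lemma mem_greedy s x S : uniq s ->
  (x \in greedy s F S) = [&& x \in s, x \in S & available s x S].
Proof.
elim/last_ind: s x => [|s y IH] x; first by rewrite inE.
rewrite rcons_uniq => /andP[ys us]; rewrite greedy_rcons mem_rcons inE.
have [->|neq] := eqVneq x y.
  rewrite available_rcons //=; case: ifP => [_|]; first by rewrite setU11.
  by rewrite IH // (negPf ys).
have -> : [&& x \in s, x \in S & available (rcons s y) x S] =
          [&& x \in s, x \in S & available s x S].
  by case xs: (x \in s) => //=; rewrite -cats1 available_cat.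
by rewrite -IH //=; case: ifP => // _; rewrite !inE (negPf neq).
Qed.

Definition avail_set s S := [set x in s | available s x S].

Lemma avail_set_rcons s x S : x \notin s -> avail_set (rcons s x) S =
  if available (rcons s x) x S then x |: avail_set s S else avail_set s S.
Proof.
move=> xs; apply/setP => y; rewrite inE mem_rcons inE.
have [->|neq] := eqVneq y x.
  by case: ifP => _ /=; rewrite ?setU11 // !inE (negPf xs).
transitivity ((y \in s) && available s y S); last first.
  by case: ifP => _; rewrite !inE ?(negPf neq).
by case ys: (y \in s) => //=; rewrite -cats1 available_cat.
Qed.

Lemma card_greedy s S : uniq s ->
  #|greedy s F S| = (\sum_(x <- s) ((x \in S) && available s x S))%N.
Proof.
move=> us.
rewrite sum_bool_card //; congr #|pred_of_set _|.
by apply/setP => x; rewrite mem_greedy // inE.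
Qed.

Lemma greedy_sub_avail s S : uniq s -> greedy s F S \subset avail_set s S.
Proof.
by move=> us; apply/subsetP => x; rewrite mem_greedy // inE => /and3P[-> _ ->].
Qed.

Definition blocked (M : matroid T) s x S : bool :=
  available s x S && spanned M (avail_set (take (index x s) s) S) x.

Lemma blocked_cat (M : matroid T) s t x S : x \in s ->
  blocked M (s ++ t) x S = blocked M s x S.
Proof.
move=> xs; rewrite /blocked available_cat //.
by rewrite index_cat xs take_cat index_mem xs.
Qed.

Lemma eq_blocked (M : matroid T) s x S S' : uniq s ->
  (forall y, y != x -> (y \in S) = (y \in S')) ->
  blocked M s x S = blocked M s x S'.
Proof.
move=> us SS'; rewrite /blocked (eq_available _ SS'); congr (_ && spanned _ _ _).
apply/setP => y; rewrite !inE; case yt: (y \in _) => //=.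
rewrite /available (@eq_greedy _ S S') // => z zt; apply: SS'.
apply: contraTneq (mem_take zt) => ->.
by apply/negP => /index_ltn; rewrite ltnn.
Qed.

(** Along the scan, a new available element raises the rank by one exactly when the earlier
    available ones do not span it. *)
Lemma rank_avail_set (M : matroid T) s S : uniq s ->
  rank M (avail_set s S) =
    (\sum_(x <- s) (available s x S && ~~ blocked M s x S))%N.
Proof.
elim/last_ind: s => [|s x IH].
  rewrite big_nil => _; apply/eqP; rewrite -leqn0.
  by apply/bigmax_leqP => B /andP[_ /subset_leq_card]; rewrite /avail_set
    (_ : [set x in _ | _] = set0) ?cards0 //; apply/setP => x; rewrite !inE.
rewrite rcons_uniq => /andP[xs us]; rewrite big_rcons /=.
rewrite (eq_big_seq (fun y => (available s y S && ~~ blocked M s y S) : nat)).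
  rewrite -IH // avail_set_rcons // /blocked.
  rewrite take_index_rcons //.
  by case: ifP => _ /=; rewrite ?addn0 // rankU1E.
by move=> y ys; rewrite -cats1 available_cat // blocked_cat.
Qed.

End Greedy.

(** * Expectation under [mu] *)

Section Expectation.
Variables (R : realFieldType) (T : finType) (p : R).
Implicit Types (f g : {set T} -> R).

Lemma expect_mu_cst (c : R) : expect_mu (T := T) p (fun=> c) = c.
Proof.
rewrite /expect_mu /mu -big_distrl /= -[RHS]mul1r; congr (_ * _).
rewrite -(bigA_distr _ _ (fun=> p) (fun=> 1 - p)).
by rewrite big1 //= => x _; rewrite addrC subrK.
Qed.

Lemma mu_ge0 (S : {set T}) : 0 <= p <= 1 -> 0 <= mu p S.
Proof.
by move=> /andP[p0 p1]; apply: prodr_ge0 => x _; case: ifP => // _; lra.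
Qed.

Lemma expect_mu_le f g : 0 <= p <= 1 -> (forall S, f S <= g S) ->
  expect_mu p f <= expect_mu p g.
Proof.
move=> p01 fg; apply: ler_sum => S _.
by rewrite ler_wpM2l ?mu_ge0.
Qed.

Lemma expect_mu_sum (I : Type) (r : seq I) (P : pred I) (f : I -> {set T} -> R) :
  expect_mu p (fun S => \sum_(i <- r | P i) f i S) =
  \sum_(i <- r | P i) expect_mu p (f i).
Proof.
by rewrite exchange_big; apply: eq_bigr => S _; rewrite big_distrr.
Qed.

Lemma expect_muB f g :
  expect_mu p (fun S => f S - g S) = expect_mu p f - expect_mu p g.
Proof. by rewrite -sumrB; apply: eq_bigr => S _; rewrite mulrBr. Qed.

Lemma expect_muZ c f : expect_mu p (fun S => c * f S) = c * expect_mu p f.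
Proof. by rewrite big_distrr; apply: eq_bigr => S _; rewrite /= mulrCA. Qed.

Lemma eq_expect_mu f g : f =1 g -> expect_mu p f = expect_mu p g.
Proof. by move=> fg; apply: eq_bigr => S _; rewrite fg. Qed.

(** Pair each [S] missing [x] with [x |: S]: [f] and the remaining factors [m] of [mu] agree on
    both, so only the factors [1 - p] and [p] at [x] differ. *)
Lemma expect_mu_indep x f :
  (forall S S' : {set T}, (forall y, y != x -> (y \in S) = (y \in S')) -> f S = f S') ->
  expect_mu p (fun S => (x \in S)%:R * f S) = p * expect_mu p f.
Proof.
move=> fx.
pose m (S : {set T}) : R := \prod_(y | y != x) (if y \in S then p else 1 - p).
have muE S : mu p S = (if x \in S then p else 1 - p) * m S.
  by rewrite /mu (bigD1 x).
have Ein (h : {set T} -> R) :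
    \sum_(S : {set T} | x \in S) h S =
    \sum_(S : {set T} | x \notin S) h (x |: S).
  rewrite (reindex_onto (fun S => x |: S) (fun S => S :\ x)) /=; last first.
    by move=> S xS; rewrite setD1K.
  apply: eq_bigl => S; rewrite setU11 /=; apply/eqP/idP => [<-|xS].
    by rewrite setD11.
  by rewrite setU1K.
have mU S : m (x |: S) = m S.
  by apply: eq_bigr => y yx; rewrite !inE (negPf yx).
have fU S : f (x |: S) = f S.
  by apply: fx => y yx; rewrite !inE (negPf yx).
have Hin : \sum_(S : {set T} | x \in S) mu p S * f S =
    p * \sum_(S : {set T} | x \notin S) m S * f S.
  rewrite Ein big_distrr; apply: eq_bigr => S _ /=.
  by rewrite muE setU11 mU fU mulrA.
have Hout : \sum_(S : {set T} | x \notin S) mu p S * f S =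
    (1 - p) * \sum_(S : {set T} | x \notin S) m S * f S.
  rewrite big_distrr; apply: eq_bigr => S xS /=.
  by rewrite muE (negPf xS) mulrA.
rewrite /expect_mu (bigID (fun S : {set T} => x \in S)) /=.
rewrite [X in _ + X]big1; last first.
  by move=> S /negPf ->; rewrite mul0r mulr0.
under eq_bigr => S xS do rewrite xS mul1r.
rewrite addr0 [in RHS](bigID (fun S : {set T} => x \in S)) /= Hin Hout.
ring.
Qed.

End Expectation.

(** * Abel summation along non-increasing weights *)

Section PrefixSums.
Variables (R : realFieldType) (T : Type) (w : T -> R).
Hypothesis w_ge0 : forall x, 0 <= w x.

(* [c] is the sum of [f] over the elements already consumed, [v] the last one. *)
Lemma abel_path_ge0 (f : T -> R) (s : seq T) (c : R) (v : T) :
  path (fun x y => w y <= w x) v s ->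
  (forall n, 0 <= c + \sum_(x <- take n s) f x) ->
  0 <= w v * c + \sum_(x <- s) w x * f x.
Proof.
elim: s c v => [|x s IH] c v /=.
  by move=> _ /(_ 0); rewrite !big_nil !addr0 => c0; rewrite mulr_ge0.
move=> /andP[wxv ps] H.
(* The empty prefix gives [0 <= c], so replacing [w v] by the smaller [w x] in front of [c] can only
   lower the sum. *)
have c0 : 0 <= c by have := H 0; rewrite take0 big_nil addr0.
have := IH (c + f x) x ps; rewrite big_cons => IH'.
apply: le_trans (IH' _) _.
  by move=> n; have := H n.+1; rewrite /= big_cons addrA.
by rewrite mulrDr -addrA lerD2r ler_wpM2r.
Qed.

Lemma abel_sorted_ge0 (f : T -> R) (s : seq T) :
  sorted (fun x y => w y <= w x) s ->
  (forall n, 0 <= \sum_(x <- take n s) f x) ->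
  0 <= \sum_(x <- s) w x * f x.
Proof.
case: s => [|x s] /= ps H; first by rewrite big_nil.
have := @abel_path_ge0 f s (f x) x ps; rewrite big_cons; apply.
by move=> n; have := H n.+1; rewrite /= big_cons.
Qed.

End PrefixSums.

(** * Greedy against an arbitrary common independent set *)

Section CommonIndep.
Variables (T : finType) (k : nat) (M : 'I_k -> matroid T).
Let F := common_indep M.

Lemma common_indep0 : set0 \in F.
Proof. by apply/bigcapP => j _; apply: indep0. Qed.

Lemma common_indepS (A B : {set T}) : A \subset B -> B \in F -> A \in F.
Proof.
by move=> AB /bigcapP BF; apply/bigcapP => j _; apply: indepS AB (BF j isT).
Qed.

Lemma common_indepE (A : {set T}) j : A \in F -> A \in indep (M j).
Proof. by move/bigcapP; apply. Qed.

Hypothesis k_gt0 : (0 < k)%N.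

(* Every element rejected by the greedy algorithm is spanned by the output in
   some [M j], and [A] contains at most [#|greedy|] elements spanned in [M j]. *)
Lemma card_le_greedy (A S : {set T}) (s : seq T) : uniq s -> A \in F ->
  (#|[set x in s | (x \in S) && (x \in A)]| <= k * #|greedy s F S|)%N.
Proof.
move=> us AF; set G := greedy s F S.
have GM j : G \in indep (M j).
  by apply: common_indepE; apply: greedy_indep common_indep0.
pose B j := [set x in A | spanned (M j) G x].
apply: (@leq_trans #|\bigcup_j B j|).
  apply: subset_leq_card; apply/subsetP => x; rewrite inE => /and3P[xs xS xA].
  suff [j sj] : exists j, spanned (M j) G x.
    by apply/bigcupP; exists j; rewrite ?inE ?xA.
  have [xG|] := boolP (x \in G).
    by exists (Ordinal k_gt0); apply: spanned_mem.
  rewrite mem_greedy // xs xS /= /available; set G' := greedy _ F S => xG'.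
  (* [G'] is the greedy solution just before [x]; elements are never removed, so being spanned by
     [G'] passes to [G]. *)
  have G'G : G' \subset G.
    apply/subsetP => y; rewrite /G' /G !mem_greedy ?take_uniq //.
    move=> /and3P[yt -> Hy]; rewrite (mem_take yt) /=.
    by rewrite -(cat_take_drop (index x s) s) available_cat.
  have [j xj] : exists j, x |: G' \notin indep (M j).
    apply/existsP; apply: contraNT xG'; rewrite negb_exists => /forallP H.
    by apply/bigcapP => j _; have := H j; rewrite negbK.
  exists j; apply: spannedS G'G _; apply: spannedN_indep xj.
  by apply: common_indepE; apply: greedy_indep common_indep0.
apply: (@leq_trans (\sum_j #|B j|)).
  elim/big_ind2: _ => [|m1 X m2 Y H1 H2|//]; first by rewrite cards0.
  by apply: leq_trans (leq_add H1 H2); rewrite cardsU leq_subr.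
have -> : (k * #|G| = \sum_(j < k) #|G|)%N by rewrite sum_nat_const card_ord.
apply: leq_sum => j _.
apply: (@card_spanned _ (M j)) => // [|x]; last by rewrite inE => /andP[].
apply: indepS (common_indepE j AF); apply/subsetP => x.
by rewrite inE => /andP[].
Qed.

End CommonIndep.

(** * The optimum of a single matroid *)

Section Optimum.
Variables (R : realFieldType) (T : finType) (e : seq T).
Hypothesis e_all : forall x, x \in e.

(** Otherwise [x] could be swapped into the optimum at the cost of at most one element, later in [e]
    and hence no heavier; the result would be heavier, or equally heavy and favoured by the
    tie-breaking. *)
Lemma opt_spanned (M : matroid T) (u : T -> R) (x : T) : 0 < u x ->
  (forall y, (index x e < index y e)%N -> u y <= u x) ->
  x \notin opt e (indep M) u ->
  spanned M [set y in opt e (indep M) u | (index y e < index x e)%N] x.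
Proof.
set X := opt _ _ _ => ux umax xX.
have /andP[/and3P[XM /forall_inP Xmax /forall_inP Xn0] /forallP Xpref] :
    is_opt e (indep M) u X.
  apply: optP => //; [exact: indep0 | exact: indepS].
set X' := [set y in X | _].
have X'X : X' \subset X by apply/subsetP => y; rewrite inE => /andP[].
have [xX'M|] := boolP (x |: X' \in indep M); last first.
  by apply: spannedN_indep; apply: indepS XM.
exfalso.
(* [Y] is [x |: X], or [x |: X] minus one element coming after [x]. *)
have [Y [YM xX'Y YxX cY]] := extend_to_rank xX'M (setUS [set x] X'X).
have xY : x \in Y by apply: (subsetP xX'Y); rewrite setU11.
have YX : Y :\ x = X :&: Y.
  apply/setP => y; rewrite !inE; have [->|neq] /= := eqVneq y x.
    by rewrite (negPf xX).
  case yY: (y \in Y); rewrite ?andbF //.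
  by have := subsetP YxX y yY; rewrite !inE (negPf neq) /= => ->.
(* [Y] has the rank of [x |: X], so it is at least as large as [X] while containing the new element
   [x]. *)
have cX : (#|X :\: Y| <= 1)%N.
  have := leq_rank XM (subsetUr [set x] X); rewrite -cY (cardsD1 x Y) xY YX.
  by rewrite -(cardsID Y X) addnC leq_add2r.
have wY : wt u Y = u x + wt u (X :&: Y).
  by rewrite /wt (big_setD1 x) //= YX.
have wX : wt u X = wt u (X :\: Y) + wt u (X :&: Y).
  by rewrite /wt (big_setID Y) /= addrC.
have lexD : u x <= wt u (X :\: Y).
  by have := Xmax Y YM; rewrite wY wX lerD2r.
have [E|/set0Pn [y yXY]] := eqVneq (X :\: Y) set0.
  by move: lexD; rewrite E /wt big_set0 leNgt ux.
have E : X :\: Y = [set y].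
  apply/esym/eqP; rewrite eqEcard sub1set yXY cards1; exact: cX.
move: lexD; rewrite E /wt big_set1 => lexy.
have /setDP[yX yY] := yXY.
have ltxy : (index x e < index y e)%N.
  rewrite ltn_neqAle; apply/andP; split.
    apply/eqP => H; move/negP: xX; apply.
    by rewrite -(nth_index x (e_all x)) H nth_index.
  rewrite leqNgt; apply: contra yY => ltyx.
  by apply: (subsetP xX'Y); rewrite !inE yX ltyx orbT.
have eqw : wt u Y = wt u X.
  rewrite wX wY E [wt u [set y]]big_set1; congr (_ + _); apply/eqP.
  by rewrite eq_le lexy umax.
have Ymax : max_weight (indep M) u Y.
  apply/and3P; split=> //.
    by apply/forall_inP => Z /Xmax; rewrite eqw.
  apply/forall_inP => z zY; have := subsetP YxX z zY; rewrite !inE.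
  by case/orP => [/eqP ->|/Xn0 //]; rewrite gt_eqF.
(* [X] would have to win the tie through an element of [X :\: Y] preceding [x], but [y] is the only
   candidate and comes later. *)
have := implyP (Xpref Y) Ymax => /preferredP[XY|[z /andP[zX zY] H]].
  by move: xX; rewrite XY xY.
have : z \in X :\: Y by rewrite inE zY.
rewrite E inE => /eqP Ez; have := H x xY xX.
by rewrite Ez ltnNge (ltnW ltxy).
Qed.

Hypothesis e_uniq : uniq e.
Implicit Type S : {set T}.

Lemma residual_weightE (F : {set {set T}}) (w : T -> R) S x :
  residual_weight e F w S x =
  if (x \notin S) && available F e x S then w x else 0.
Proof.
rewrite /residual_weight mem_greedy // e_all setU11 /=.
by rewrite (@eq_available _ F e x (x |: S) S) // => y yx; rewrite !inE (negPf yx).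
Qed.

(** Elements of the optimum have nonzero residual weight, hence are available. So those before [x],
    which span it by [opt_spanned], lie in the available set. That lemma applies because [x] keeps
    its full weight [w x]. *)
Lemma residual_blocked (F : {set {set T}}) (M : matroid T) (w : T -> R) S x :
  sorted (fun x y => w y <= w x) e -> (forall y, 0 <= w y) ->
  x \notin S -> available F e x S -> 0 < w x ->
  x \notin opt e (indep M) (residual_weight e F w S) ->
  blocked F M e x S.
Proof.
move=> e_sorted w_ge0 xS xa wx xX; rewrite /blocked xa /=.
have ux : residual_weight e F w S x = w x by rewrite residual_weightE xS xa.
apply: spannedS (opt_spanned _ _ xX); last 2 first.
- by rewrite ux.
- move=> y ltxy; rewrite ux residual_weightE; case: ifP => _ //.
  apply: (sorted_ltn_index _ e_sorted) => //.
  by move=> a b c /= H1 H2; apply: le_trans H2 H1.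
apply/subsetP => y; rewrite !inE => /andP[yX ltyx].
have yt : y \in take (index x e) e.
  by rewrite in_take.
rewrite yt /= -(available_cat F (drop (index x e) e)) // cat_take_drop.
have /andP[/and3P[_ _ /forall_inP Xn0] _] :
    is_opt e (indep M) (residual_weight e F w S)
      (opt e (indep M) (residual_weight e F w S)).
  apply: optP => //; [exact: indep0 | exact: indepS].
by have := Xn0 y yX; rewrite residual_weightE; case: ifP => [/andP[]|]; rewrite ?eqxx.
Qed.

End Optimum.

(** * Expected numbers of available and blocked elements *)

Section ExpectedCounts.
Variables (R : realFieldType) (T : finType) (p : R).
Hypothesis p01 : 0 <= p <= 1.

Lemma expect_mu_mem_available (F : {set {set T}}) (s : seq T) x :
  expect_mu p (fun S => ((x \in S) && available F s x S)%:R) =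
  p * expect_mu p (fun S => (available F s x S)%:R).
Proof.
rewrite -(expect_mu_indep p (x := x)); last first.
  by move=> S S' SS'; rewrite (eq_available F s SS').
by apply: eq_expect_mu => S; rewrite -mulnb natrM.
Qed.

(* The greedy solution is independent in [M] and contained in the available set,
   whose rank counts the available elements that are not blocked; hence
   [p * sum A <= sum A - sum B]. *)
Lemma expect_blocked_le (F : {set {set T}}) (M : matroid T) (s : seq T) :
  uniq s -> set0 \in F -> F \subset indep M ->
  \sum_(x <- s) expect_mu p (fun S => (blocked F M s x S)%:R) <=
  (1 - p) * \sum_(x <- s) expect_mu p (fun S => (available F s x S)%:R).
Proof.
move=> us F0 FM; rewrite mulrBl mul1r lerBrDr -lerBrDl big_distrr -sumrB /=.
under eq_bigr do rewrite -expect_mu_mem_available.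
under [leRHS]eq_bigr do rewrite -expect_muB.
rewrite -!expect_mu_sum; apply: expect_mu_le => // S.
rewrite -natr_sum -card_greedy //.
have -> : \sum_(x <- s) ((available F s x S)%:R - (blocked F M s x S)%:R) =
    (rank M (avail_set F s S))%:R :> R.
  rewrite rank_avail_set // natr_sum; apply: eq_bigr => x _.
  rewrite /blocked; case: (available _ _ _ _); case: (spanned _ _ _) => /=;
  by rewrite ?subrr ?subr0.
rewrite ler_nat leq_rank ?greedy_sub_avail //.
by apply: (subsetP FM); apply: greedy_indep.
Qed.

(** Take expectations in [card_le_greedy]: both the part of [A] inside [S] and the greedy solution
    pick up a factor [p], which cancels. *)
Lemma expect_available_ge (k : nat) (M : 'I_k -> matroid T) (A : {set T})
    (s : seq T) : (0 < k)%N -> 0 < p -> uniq s -> A \in common_indep M ->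
  \sum_(x <- s) (x \in A)%:R <= k%:R *
    \sum_(x <- s) expect_mu p (fun S => (available (common_indep M) s x S)%:R).
Proof.
move=> k_gt0 p_gt0 us AF; set F := common_indep M.
rewrite -(ler_pM2l p_gt0) mulrCA !big_distrr /=.
under [in leRHS]eq_bigr do rewrite -expect_mu_mem_available.
have E x : p * (x \in A)%:R =
    expect_mu p (fun S => ((x \in S) && (x \in A))%:R).
  rewrite -[X in p * X](expect_mu_cst T p).
  rewrite -(expect_mu_indep p (x := x)) //.
  by apply: eq_expect_mu => S; rewrite -mulnb natrM.
under eq_bigr do rewrite E.
rewrite -big_distrr /= -!expect_mu_sum -expect_muZ.
apply: expect_mu_le => // S.
rewrite -!natr_sum -card_greedy // sum_bool_card // -natrM ler_nat.
exact: card_le_greedy.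
Qed.

End ExpectedCounts.

(** * Assembling the bound *)

Theorem theorem7 (R : realFieldType) (T : finType) (k : nat) (k_gt0 : (0 < k)%N)
    (M : 'I_k -> matroid T) (w : T -> R) (w_ge0 : forall x, 0 <= w x)
    (e : seq T) (e_order : weight_ordering w e) :
  let F := common_indep M in
  let OPT := opt e F w in
  let w' := residual_weight e F w in
  let OPT' S j := opt e (indep (M j)) (w' S) in
  let p : R := (2 * k%:R - 1) / (2 * k%:R) in
  expect_mu p (fun S => wt (w' S) (\bigcap_(j < k) OPT' S j))
    >= 1 / (4 * k%:R ^+ 2) * wt w OPT.
Proof.
cbv zeta; set F := common_indep M; set OPT := opt e F w.
set w' := residual_weight e F w; set p : R := (2 * k%:R - 1) / (2 * k%:R).
pose OPT' S j := opt e (indep (M j)) (w' S); case: e_order => e_uniq e_all e_sorted.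
have k_ge1 : 1 <= k%:R :> R by rewrite ler1n.
have k_neq0 : k%:R != 0 :> R by rewrite pnatr_eq0 -lt0n.
have qE : 1 - p = (2 * k%:R)^-1 by rewrite /p; field.
have q_gt0 : 0 < 1 - p by rewrite qE invr_gt0; lra.
have p_gt0 : 0 < p by rewrite /p divr_gt0 //; lra.
have p01 : 0 <= p <= 1 by rewrite ltW //=; lra.
have F0 : set0 \in F := common_indep0 M.
have OPTF : OPT \in F.
  have /andP[/and3P[]//] : is_opt e F w OPT.
  by apply: optP => // A B; apply: common_indepS.
have wtE u (X : {set T}) : wt u X = \sum_(x <- e) u x * (x \in X)%:R.
  rewrite /wt big_mkcond /= (perm_big e) /=; last first.
    apply: uniq_perm; rewrite ?index_enum_uniq // => x.
    by rewrite mem_index_enum e_all.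
  by apply: eq_bigr => x _; case: ifP => _; rewrite ?mulr1 ?mulr0.
pose a x (S : {set T}) : R := (available F e x S)%:R.
pose b j x (S : {set T}) : R := (blocked F (M j) e x S)%:R.
(* A lower bound, by a union bound over the matroids, for the probability that [x] has positive
   residual weight and is in every [OPT' S j], when [w x] is positive. *)
pose f x : R := (1 - p) * (expect_mu p (a x) - \sum_(j < k) expect_mu p (b j x)).
have lower : \sum_(x <- e) w x * f x <=
    expect_mu p (fun S => wt (w' S) (\bigcap_(j < k) OPT' S j)).
  pose g x (S : {set T}) := a x S - \sum_(j < k) b j x S.
  (* [g x] does not depend on whether [x] is in [S], so the indicator of [x \notin S] factors out as
     [1 - p]. *)
  have fE x : w x * f x =
      expect_mu p (fun S => w x * (g x S - (x \in S)%:R * g x S)).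
    rewrite expect_muZ expect_muB expect_mu_indep => [|S S' SS'].
      by rewrite /g expect_muB expect_mu_sum -/(b _ _) /f mulrBl mul1r.
    rewrite /g /a /b (eq_available F e SS'); congr (_ - _).
    by apply: eq_bigr => j _; rewrite (eq_blocked F (M j) e_uniq SS').
  under eq_bigr do rewrite fE.
  rewrite -expect_mu_sum; apply: expect_mu_le => // S.
  rewrite wtE; apply: ler_sum => x _.
  have b_ge0 : 0 <= \sum_(j < k) b j x S.
    by apply: sumr_ge0 => j _; rewrite /b ler0n.
  have w_x := w_ge0 x.
  rewrite /w' residual_weightE // /g.
  have [xS|xS] /= := boolP (x \in S); first by rewrite mul1r subrr mulr0 mul0r.
  rewrite mul0r subr0 /a.
  have [xa|xa] /= := boolP (available F e x S); last by rewrite mul0r; nra.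
  have [xX|xX] := boolP (x \in _); first by rewrite mulr1; nra.
  rewrite mulr0; have [->|wn0] := eqVneq (w x) 0; first by rewrite mul0r.
  have wx_gt0 : 0 < w x by rewrite lt_def wn0.
  (* A lost residual element is blocked in some [M j], which makes [g x S] at most 0. *)
  have [j xj] : exists j, x \notin OPT' S j.
    apply/existsP; apply: contraNT xX; rewrite negb_exists => /forallP H.
    by apply/bigcapP => j _; have := H j; rewrite negbK.
  have bj : b j x S = 1.
    by rewrite /b (residual_blocked e_all e_uniq _ _ xS xa wx_gt0 xj).
  have : 1 <= \sum_(j < k) b j x S.
    by rewrite (bigD1 j) //= bj lerDl; apply: sumr_ge0 => i _; rewrite /b ler0n.
  nra.
apply: le_trans lower; rewrite wtE big_distrr -subr_ge0 -sumrB /=.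
under eq_bigr => x _ do rewrite [1 / _ * _]mulrCA -mulrBr.
(* It remains to compare unweighted counts on each prefix [s]. *)
apply: abel_sorted_ge0 => // n; set s := take n e.
have us : uniq s by apply: take_uniq.
have aE x S : x \in s -> available F e x S = available F s x S.
  by move=> xs; rewrite -(cat_take_drop n e) available_cat.
have bE j x S : x \in s -> blocked F (M j) e x S = blocked F (M j) s x S.
  by move=> xs; rewrite -(cat_take_drop n e) blocked_cat.
pose A := \sum_(x <- s) expect_mu p (a x).
have AE : A = \sum_(x <- s) expect_mu p (fun S => (available F s x S)%:R).
  by apply: eq_big_seq => x xs; apply: eq_expect_mu => S; rewrite /a aE.
have B_le j : \sum_(x <- s) expect_mu p (b j x) <= (1 - p) * A.
  rewrite AE (eq_big_seq (fun x => expect_mu p (fun S =>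
    (blocked F (M j) s x S)%:R))) => [|x xs]; last first.
    by apply: eq_expect_mu => S; rewrite /b bE.
  apply: expect_blocked_le => //.
  by apply/subsetP => X; apply: common_indepE.
have A_ge : \sum_(x <- s) (x \in OPT)%:R <= k%:R * A.
  by rewrite AE; apply: expect_available_ge.
have B_sum : \sum_(x <- s) \sum_(j < k) expect_mu p (b j x) <= k%:R * ((1 - p) * A).
  rewrite exchange_big /=.
  have -> : k%:R * ((1 - p) * A) = \sum_(j < k) (1 - p) * A.
    by rewrite sumr_const card_ord mulr_natl.
  exact: ler_sum.
rewrite sumrB -!big_distrr sumrB /= -/A.
(* The chosen [p] maximizes [q * (1 - k * q)] for [q = 1 - p]: blocking costs at most half of
   [A]. *)
have kq : k%:R * ((1 - p) * A) = A / 2 by rewrite qE; field.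
rewrite kq in B_sum.
(* The factors are [1 - p] for avoiding [S], one half for blocking, and [1 / k] for greedy. *)
have -> : 1 / (4 * k%:R ^+ 2) = (1 - p) / (2 * k%:R) by rewrite qE; field.
rewrite subr_ge0 -mulrA ler_pM2l // mulrC ler_pdivrMr; last lra.
nra.
Qed.
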